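(* Let $\mathrm{Peak}^c_{\mathcal N_2(0)}(t)=0$ and, for $n\ge1$, let $\mathrm{Peak}^c_{\mathcal N_2(n)}(t)=\sum t^{\mathrm{peak}(\mathbf a)}$, the sum being over all area sequences $\mathbf a$ of size $n$ with $\mathrm{pnest}(\mathbf a)\le2$ and $\Gamma_{\mathbf a}$ connected. Then $\mathrm{Peak}^c_{\mathcal N_2(1)}(t)=\mathrm{Peak}^c_{\mathcal N_2(2)}(t)=t$, and for $n\ge3$ $$\mathrm{Peak}^c_{\mathcal N_2(n)}(t)=(t+2)\,\mathrm{Peak}^c_{\mathcal N_2(n-1)}(t)-\mathrm{Peak}^c_{\mathcal N_2(n-2)}(t).$$ Moreover, $\mathrm{Peak}^c_{\mathcal N_2(n)}(t)$ is real-rooted for every $n\ge0$ and $\{\mathrm{Peak}^c_{\mathcal N_2(n)}(t)\}_{n\ge0}$ is a generalized Sturm sequence.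
   Context: Write $[n]=\{1,\dots,n\}$. An area sequence of size $n$ is a sequence $\mathbf a=(a_1,\dots,a_n)$ of nonnegative integers with $a_i<i$ for all $i$ and $a_i\le a_{i-1}+1$ for all $i\ge 2$. It defines a graph $\Gamma_{\mathbf a}$ (a unit interval graph) on $[n]$ with edges $\{j,i\}$ for $1\le j<i\le n$ with $i-a_i\le j$. If $\{i,j\}$ with $i<j$ is an edge then $\{i,i+1,\dots,j\}$ is a clique. A peak-edge of $\Gamma_{\mathbf a}$ is either an isolated vertex $i$ (put $j=i$) or an edge $\{i,j\}$, $i<j$, such that neither $\{i,j+1\}$ nor $\{i-1,j\}$ is an edge (pairs not contained in $[n]$ are not edges). The corresponding peak-clique is $\{i,\dots,j\}$. The number of peak-edges is $\mathrm{peak}(\mathbf a)$. The peak-nesting of a vertex is the number of peak-cliques containing it, and $\mathrm{pnest}(\mathbf a)$ is the maximum over all vertices. A real polynomial is real-rooted if all its zeros are real (constants, including $0$, are real-rooted). For real-rooted $f,g$ with positive leading coefficients and zeros (with multiplicity) $\cdots\le\lambda_2\le\lambda_1$ and $\cdots\le\delta_2\le\delta_1$ respectively, write $g\ll f$ if $\cdots\le\delta_2\le\lambda_2\le\delta_1\le\lambda_1$ (so the degrees differ by at most one, $\deg g\le\deg f$); by convention also $0\ll0$, $0\ll f$, $f\ll0$. A sequence $\{f_i\}_{i\ge0}$ of real-rooted polynomials with positive leading coefficients (the zero polynomial being allowed under this convention) is a generalized Sturm sequence if $f_{i-1}\ll f_i$ for all $i\ge1$. *)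

(* Defs.v *)
From HB Require Import structures.
From mathcomp Require Import all_boot all_order all_algebra.
From mathcomp Require Import complex.
From mathcomp Require Import reals.

Set Implicit Arguments.
Unset Strict Implicit.
Unset Printing Implicit Defensive.

Import Order.TTheory GRing.Theory Num.Theory.

(* Indices and vertices are shifted to {0, ..., n-1}: the ordinal i stands for
   i+1 in [n].  An area sequence has a_i < i <= n, so its entries are in 'I_n;
   after the shift, a_i < i becomes a i <= i. *)
Definition area_seq n (a : {ffun 'I_n -> 'I_n}) : bool :=
  [forall i, a i <= i]
  && [forall i : 'I_n, forall j : 'I_n, (j == i.+1 :> nat) ==> (a j <= (a i).+1)].

Section UnitIntervalGraph.
Variables (n : nat) (a : {ffun 'I_n -> 'I_n}).

(* i - a_i <= j without subtraction. *)
Definition edge_lt (j i : 'I_n) : bool := (j < i) && (i <= j + a i).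

Definition adj : rel 'I_n := fun i j => edge_lt i j || edge_lt j i.

Definition isolated (i : 'I_n) : bool := [forall k, ~~ adj i k].

(* The edge {i, j} with i < j is the pair (i, j), and an isolated vertex i is
   the pair (i, i).  The quantifiers range over 'I_n, so that a pair
   {i, j+1} or {i-1, j} not contained in the vertex set is not an edge. *)
Definition peak_edge (p : 'I_n * 'I_n) : bool :=
  ((p.1 == p.2) && isolated p.1)
  || [&& p.1 < p.2, adj p.1 p.2,
         [forall k : 'I_n, (k == p.2.+1 :> nat) ==> ~~ adj p.1 k]
       & [forall k : 'I_n, (k.+1 == p.1 :> nat) ==> ~~ adj k p.2]].

Definition peak : nat := #|[set p | peak_edge p]|.

Definition interval (p : 'I_n * 'I_n) : {set 'I_n} :=
  [set v : 'I_n | p.1 <= v <= p.2].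

Definition peak_cliques : {set {set 'I_n}} :=
  [set interval p | p in [set p | peak_edge p]].

Definition peak_nesting (v : 'I_n) : nat :=
  #|[set K in peak_cliques | v \in K]|.

Definition pnest : nat := \max_(v < n) peak_nesting v.

Definition connected : bool := [forall i, forall j, connect adj i j].

End UnitIntervalGraph.

Local Open Scope ring_scope.

Definition conn_peak_poly (R : realType) (n : nat) : {poly R} :=
  if n == 0%N then 0
  else \sum_(a : {ffun 'I_n -> 'I_n}
              | [&& area_seq a, (pnest a <= 2)%N & connected a]) 'X^(peak a).

Section RealRooted.
Variable R : realType.
Implicit Types f g p : {poly R}.

(* The zero polynomial is real-rooted by convention. *)
Definition real_rooted p : Prop :=
  p = 0 \/
  forall z : R[i], root (map_poly (real_complex R) p) z -> complex.Im z = 0.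

Definition zeros_of p (s : seq R) : Prop :=
  sorted >=%R s /\ forall x : R, count_mem x s = mup x p.

(* Real-rooted with positive leading coefficient, or zero. *)
Definition admissible p : Prop :=
  real_rooted p /\ (p = 0 \/ 0 < lead_coef p).

(* The chain ... <= delta_2 <= lambda_2 <= delta_1 <= lambda_1 ends either
   with a delta (equal degrees) or with a lambda (deg f = deg g + 1). *)
Definition interlaces g f : Prop :=
  [/\ admissible g, admissible f &
      [\/ g = 0, f = 0 |
       exists delta lambda : seq R,
         [/\ zeros_of g delta, zeros_of f lambda,
             (size delta <= size lambda <= (size delta).+1)%N,
             forall i, (i < size delta)%N -> delta`_i <= lambda`_i
           & forall i, (i.+1 < size lambda)%N -> lambda`_i.+1 <= delta`_i]]].

Definition generalized_sturm (F : nat -> {poly R}) : Prop :=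
  (forall i, admissible (F i)) /\
  (forall i, (1 <= i)%N -> interlaces (F i.-1) (F i)).

End RealRooted.

(* Main.v *)
(* Write low(i) = i - a_i for the leftmost neighbour of i (or i itself).  An area
   sequence is the same as a weakly increasing low with low(i) <= i; the graph is
   connected iff low(i) < i for i > 0; the peak-edges are the pairs (low(i), i)
   where i is last or low jumps after i; and pnest <= 2 iff low(j+1) > i whenever
   low jumps after i and after j with i < j.  So, when a vertex n is appended, low
   either keeps its last value or takes a larger value in (r, n-1], where r is the
   position of the previous jump (0 if there is none).  If P_n sums t^peak and D_n
   sums (n - 1 - r) t^peak over the admissible sequences of size n, this gives
     P_{n+1} = P_n + t D_n,   D_{n+1} = P_n + (1 + t) D_n,
   a transfer matrix of trace t + 2 and determinant 1, whence the recurrence.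

   For the zeros, P_{n+2} = t Q_n with Q_n monic of degree n, and the recurrence
   yields cos(x/2) Q_n(2 cos x - 2) = cos((n + 1/2) x).  Hence the zeros of Q_n are
   2 cos((2k+1) pi / (2n+1)) - 2 for k < n; they are negative, and interlacing is
   a comparison of angles. *)
Require Import Defs.
From HB Require Import structures.
From mathcomp Require Import all_boot all_order all_algebra.
From mathcomp Require Import complex.
From mathcomp Require Import reals trigo.
From mathcomp Require Import zify ring lra.

Import Order.TTheory GRing.Theory Num.Theory.

(** * Words of leftmost neighbours *)

(* Words are stored in reverse: the head is the value at the last vertex. *)
Fixpoint word (f : nat -> nat) n : seq nat :=
  if n is m.+1 then f m :: word f m else [::].

(* Position of the vertex just before the last jump, 0 if there is no jump. *)
Fixpoint last_jump (w : seq nat) : nat :=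
  match w with
  | x :: ((y :: v) as w') => if x == y then last_jump w' else size v
  | _ => 0
  end.

(** Number of maximal constant runs; on the word of [low] each run ends at the right end of one
    peak-edge. *)
Fixpoint blocks (w : seq nat) : nat :=
  match w with
  | x :: ((y :: _) as w') => (x != y) + blocks w'
  | [:: _] => 1
  | [::] => 0
  end.

Definition choices (w : seq nat) : nat := (size w).-1 - last_jump w.

(** Repeat the last value, or jump: a jump must exceed [last_jump w] (nesting) and be at most the
    last position of [w] (connectedness). *)
Definition extensions (w : seq nat) : seq nat :=
  head 0 w :: iota (last_jump w).+1 (choices w).

(* The words in [words n] have length n + 1. *)
Fixpoint words n : seq (seq nat) :=
  if n is m.+1 then [seq x :: w | w <- words m, x <- extensions w]
  else [:: [:: 0]].

Lemma wordsS n : words n.+1 = [seq x :: w | w <- words n, x <- extensions w].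
Proof. by []. Qed.

Definition admissible_lows (f : nat -> nat) n : Prop :=
  [/\ f 0 = 0,
      forall i, i < n -> f i <= f i.+1 <= i
    & forall i j, i < j < n -> f i < f i.+1 -> f j < f j.+1 -> i < f j.+1].

Lemma size_word f n : size (word f n) = n.
Proof. by elim: n => //= n ->. Qed.

Lemma eq_word f g n : (forall i, i < n -> f i = g i) -> word f n = word g n.
Proof.
elim: n => //= n IH fg; rewrite fg // IH // => i lin.
by apply: fg; apply: leq_trans lin _.
Qed.

Lemma word_inj f g n i : word f n = word g n -> i < n -> f i = g i.
Proof.
elim: n => // n IH /= [fgn /IH fg]; rewrite ltnS leq_eqVlt => /orP[/eqP-> //|].
exact: fg.
Qed.

(** Lets facts stated for functions, such as [mem_words], apply to an arbitrary list. *)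
Lemma word_nth (w : seq nat) : w = word (fun k => nth 0 w ((size w).-1 - k)) (size w).
Proof.
elim: w => //= x w IH; congr cons; first by rewrite subnn.
rewrite {1}IH; apply: eq_word => i lti.
by rewrite -[in RHS](prednK (leq_ltn_trans (leq0n i) lti)) subSn //; lia.
Qed.

Lemma blocks_word f n : blocks (word f n.+1) = (\sum_(k < n) (f k.+1 != f k)).+1.
Proof.
elim: n => [|n IH]; first by rewrite big_ord0.
have -> : blocks (word f n.+2) = (f n.+1 != f n) + blocks (word f n.+1) by [].
by rewrite IH big_ord_recr /= addnS addnC.
Qed.

Lemma last_jump_wordP f n (r := last_jump (word f n.+1)) :
  [/\ r <= n, forall i, r < i <= n -> f i = f n
    & (r = 0 /\ f 0 = f n) \/ (r < n /\ f r <> f r.+1)].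
Proof.
rewrite /r {r}; elim: n => [|n [le_rn fr jr]]; first by split=> //; [lia | left].
have -> : last_jump (word f n.+2)
          = if f n.+1 == f n then last_jump (word f n.+1) else n.
  by rewrite /= size_word.
case: eqP => [e|ne]; last first.
  split; first by lia.
    by move=> i; have [->|] := eqVneq i n.+1; lia.
  by right; split => //; lia.
split; first by lia.
  move=> i; have [-> //|ne] := eqVneq i n.+1 => lei.
  by rewrite e; apply: fr; lia.
by case: jr => [[-> ->]|[lt nf]]; [left | right; split=> //; lia].
Qed.

Lemma mem_words_cons x w n :
  (x :: w \in words n.+1) = (w \in words n) && (x \in extensions w).
Proof.
apply/allpairsPdep/andP => [[u [y [uw yu [-> ->]]]] //|[wn xw]].
by exists w, x.
Qed.

Lemma size_words w n : w \in words n -> size w = n.+1.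
Proof.
elim: n w => [|n IH] w; first by rewrite inE => /eqP->.
case: w => [/allpairsPdep[u [y [_ _]]] //|x w].
by rewrite mem_words_cons /= => /andP[/IH->].
Qed.

(** When a vertex is appended, the nesting condition against all earlier jumps reduces to the latest
    one, whose position is the largest. *)
Lemma mem_words f n : word f n.+1 \in words n <-> admissible_lows f n.
Proof.
elim: n => [|n IH].
  rewrite /= inE; split=> [/eqP[f0]|[-> _ _]] //.
  by split=> // i j; lia.
have -> : word f n.+2 = f n.+1 :: word f n.+1 by [].
rewrite mem_words_cons; have [] := last_jump_wordP f n.
rewrite /extensions /choices; set r := last_jump _ => le_rn fr jr.
rewrite size_word [head _ _]/= inE mem_iota.
split=> [/andP[/IH[f0 fm fj] fn1]|[f0 fm fj]].
  have le_fr : f n <= r.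
    case: jr => [[_ <-]|[lt_rn nf]]; first by rewrite f0.
    by rewrite -(fr r.+1) ?lt_rn ?leqnn //; case/andP: (fm _ lt_rn).
  split=> // [i|i j]; rewrite ltnS.
    by rewrite leq_eqVlt => /orP[/eqP->|/fm //]; lia.
  move=> /andP[lt_ij]; rewrite leq_eqVlt => /orP[/eqP ej|lt_jn]; last by apply: fj; lia.
  (* If [i <= r], the new value is a jump, hence exceeds [r]. There is no jump at [i > r], since [f]
     is constant there. *)
  rewrite {}ej in lt_ij * => fi fn; have [le_ir|lt_ri] := leqP i r; first by lia.
  have := fr i; have := fr i.+1; lia.
apply/andP; split.
  apply/IH; split=> // [i lt_in|i j lt_ij]; first by apply: fm; lia.
  by apply: fj; lia.
have := fm n (ltnSn n); rewrite leq_eqVlt eq_sym.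
case: eqP => //= ne /andP[lt_f le_f].
suff : r < f n.+1 by lia.
case: jr => [[-> f0n]|[lt_rn nf]]; first by lia.
apply: fj => //; first by lia.
by have := fm r; lia.
Qed.

(** Guarantees that the jump values in [extensions w] differ from the repeated value. *)
Lemma head_words w n : w \in words n -> head 0 w <= last_jump w <= n.
Proof.
move=> wn; move: (wn); rewrite [w]word_nth (size_words _ _ wn) => /mem_words.
set f := fun k => _; move=> [f0 fm _].
have [le_rn fr jr] := last_jump_wordP f n; rewrite le_rn andbT [head _ _]/=.
case: jr => [[_ <-]|[lt_rn nf]]; first by rewrite f0.
by rewrite -(fr (last_jump (word f n.+1)).+1) ?lt_rn ?leqnn //; case/andP: (fm _ lt_rn).
Qed.

Lemma uniq_words n : uniq (words n).
Proof.
elim: n => // n IH; apply: (@allpairs_uniq_dep _ (fun=> nat)) => //.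
  move=> w wn; rewrite /extensions cons_uniq iota_uniq andbT mem_iota.
  by have := head_words _ _ wn; lia.
by move=> [w x] [v y] _ _ /= [-> ->].
Qed.

Local Open Scope ring_scope.

(** * Generating polynomials of words and their recurrence *)

Section WordPoly.
Variable R : nzRingType.

Definition word_poly n : {poly R} := \sum_(w <- words n) 'X^(blocks w).
Definition weighted_word_poly n : {poly R} :=
  \sum_(w <- words n) 'X^(blocks w) *+ choices w.

(** Repeating keeps the last jump while the word grows, so one more choice appears. A jump opens a
    block and moves the last jump to the previous vertex, leaving one choice. *)
Lemma sum_extensions (F : nat -> nat -> {poly R}) w n : w \in words n ->
  \sum_(x <- extensions w) F (blocks (x :: w)) (choices (x :: w))
  = F (blocks w) (choices w).+1 + F (blocks w).+1 1%N *+ choices w.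
Proof.
move=> wn; rewrite big_cons; have := head_words _ _ wn; have := size_words _ _ wn.
case: w wn => [|y w] // _ [sw] /andP[hw lw].
congr (_ + _).
  rewrite /= eqxx add0n /choices /= eqxx sw.
  by rewrite subSn.
rewrite (eq_big_seq (fun=> F (blocks (y :: w)).+1 1%N)).
  by rewrite big_const_seq count_predT size_iota iter_addr_0.
move=> x; rewrite mem_iota => /andP[ltx _].
have ne : (x == y) = false by move: hw; rewrite [head _ _]/=; lia.
by rewrite /choices /= ne /= sw subSnn.
Qed.

Lemma word_polyS n : word_poly n.+1 = word_poly n + 'X * weighted_word_poly n.
Proof.
rewrite /word_poly /weighted_word_poly wordsS big_allpairs_dep.
rewrite mulr_sumr -big_split; apply: eq_big_seq => w wn.
by rewrite (sum_extensions (fun b _ => 'X^b) _ _ wn) exprS mulrnAr.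
Qed.

Lemma weighted_word_polyS n :
  weighted_word_poly n.+1 = word_poly n + ('X + 1) * weighted_word_poly n.
Proof.
rewrite /word_poly /weighted_word_poly wordsS big_allpairs_dep.
rewrite mulr_sumr -big_split; apply: eq_big_seq => w wn.
rewrite (sum_extensions (fun b c => 'X^b *+ c) _ _ wn) exprS mulrDl mul1r mulrnAr.
by rewrite mulrS mulr1n -addrA [X in _ + X]addrC.
Qed.

Lemma word_poly0 : word_poly 0 = 'X.
Proof. by rewrite /word_poly big_seq1. Qed.

Lemma weighted_word_poly0 : weighted_word_poly 0 = 0.
Proof. by rewrite /weighted_word_poly big_seq1. Qed.

End WordPoly.

Lemma word_poly_rec (R : comNzRingType) n :
  word_poly R n.+2 = ('X + 2%:P) * word_poly R n.+1 - word_poly R n.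
Proof.
rewrite word_polyS weighted_word_polyS.
have -> : 'X * (word_poly R n + ('X + 1) * weighted_word_poly R n) =
  'X * word_poly R n + ('X + 1) * ('X * weighted_word_poly R n) by ring.
(* The weighted polynomial occurs only multiplied by t, so it is eliminated without division. *)
have -> : 'X * weighted_word_poly R n = word_poly R n.+1 - word_poly R n.
  by rewrite word_polyS addrAC subrr add0r.
by rewrite (_ : 2%:P = 2%:R :> {poly R}) ?polyCMn //; ring.
Qed.
(** * Zeros of the polynomials *)

Section Roots.
Variable R : realType.

(* The polynomial of index n + 2 divided by t. *)
Fixpoint reduced_poly n : {poly R} :=
  match n with
  | 0 => 1
  | 1 => 'X + 1
  | (m.+1 as k).+1 => ('X + 2%:P) * reduced_poly k - reduced_poly m
  end.

Lemma reduced_polySS n :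
  reduced_poly n.+2 = ('X + 2%:P) * reduced_poly n.+1 - reduced_poly n.
Proof. by []. Qed.

Lemma reduced_poly_monic n :
  (size (reduced_poly n) = n.+1 /\ reduced_poly n \is monic)
  /\ (size (reduced_poly n.+1) = n.+2 /\ reduced_poly n.+1 \is monic).
Proof.
elim: n => [|n [IH1 [s2 m2]]].
  by rewrite /= size_poly1 monic1 -polyC1 size_XaddC monicXaddC.
split=> //; case: IH1 => [s1 m1]; rewrite reduced_polySS.
have sM : size (('X + 2%:P) * reduced_poly n.+1) = n.+3.
  by rewrite size_monicM ?monicXaddC ?monic_neq0 // size_XaddC s2.
have lt_s : (size (- reduced_poly n) < size (('X + 2%:P) * reduced_poly n.+1)%R)%N.
  by rewrite sM size_polyN s1; lia.
by rewrite size_polyDl // sM monicE lead_coefDl //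
  lead_coef_monicM ?monicXaddC // -monicE.
Qed.

(** At 2 cos t - 2 the factor ['X + 2%:P] becomes 2 cos t, and the recurrence is cos(u + t) + cos(u
    - t) = 2 cos t cos u. *)
Lemma reduced_poly_cos n (t : R) :
  cos (t / 2) * (reduced_poly n).[2 * cos t - 2] = cos ((n%:R + 2^-1) * t).
Proof.
suff: cos (t / 2) * (reduced_poly n).[2 * cos t - 2] = cos ((n%:R + 2^-1) * t) /\
  cos (t / 2) * (reduced_poly n.+1).[2 * cos t - 2] = cos ((n.+1%:R + 2^-1) * t) by case.
elim: n => [|n [IH1 IH2]].
  split; first by rewrite hornerC mulr1 add0r mulrC.
  rewrite /= !hornerE.
  have -> : (1 + 2^-1) * t = t + t / 2 :> R by ring.
  have half : t = t / 2 + t / 2 by field.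
  have ct : cos t = cos (t / 2) ^+ 2 - sin (t / 2) ^+ 2 by rewrite {1}half cosD !expr2.
  have st : sin t = 2 * sin (t / 2) * cos (t / 2) by rewrite {1}half sinD; ring.
  have s2 : sin (t / 2) ^+ 2 = 1 - cos (t / 2) ^+ 2 by have := cos2Dsin2 (t / 2); lra.
  rewrite cosD st ct s2.
  have -> : forall c s : R, 2 * s * c * s = 2 * s ^+ 2 * c by move=> c s; ring.
  by rewrite s2; ring.
split=> //; rewrite reduced_polySS hornerD hornerN hornerM mulrBr mulrCA.
rewrite IH1 IH2 hornerD hornerX hornerC.
have -> : (n.+2%:R + 2^-1) * t = (n.+1%:R + 2^-1) * t + t by rewrite -natr1; ring.
have -> : (n%:R + 2^-1) * t = (n.+1%:R + 2^-1) * t - t by rewrite -natr1; ring.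
rewrite cosB cosD; ring.
Qed.

Definition root_angle n k : R := k.*2.+1%:R / n.*2.+1%:R * pi.
Definition poly_roots n : seq R := [seq 2 * cos (root_angle n k) - 2 | k <- iota 0 n].

Lemma root_angle_itv n k : (k < n)%N -> root_angle n k \in `]0, pi[.
Proof.
move=> lt_kn; rewrite in_itv /= /root_angle mulr_gt0 ?pi_gt0 ?divr_gt0 //=.
by rewrite gtr_pMl ?pi_gt0 // ltr_pdivrMr // mul1r ltr_nat; lia.
Qed.

Lemma root_angle_le m n j k : (j.*2.+1 * n.*2.+1 <= k.*2.+1 * m.*2.+1)%N ->
  root_angle m j <= root_angle n k.
Proof.
move=> le; rewrite /root_angle ler_pM2r ?pi_gt0 // ler_pdivrMr // mulrAC ler_pdivlMr //.
by rewrite -!natrM ler_nat.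
Qed.

Lemma root_angle_lt n j k : (j < k)%N -> root_angle n j < root_angle n k.
Proof.
move=> le; rewrite /root_angle ltr_pM2r ?pi_gt0 // ltr_pM2r ?invr_gt0 // ltr_nat; lia.
Qed.

Lemma size_poly_roots n : size (poly_roots n) = n.
Proof. by rewrite size_map size_iota. Qed.

Lemma nth_poly_roots n k : (k < n)%N -> (poly_roots n)`_k = 2 * cos (root_angle n k) - 2.
Proof. by move=> lt; rewrite (nth_map 0%N) ?size_iota // nth_iota // add0n. Qed.

(** Cosine decreases on [0, pi], so zeros compare in reverse to the fractions (2j+1)/(2m+1) and
    (2k+1)/(2n+1), here with denominators cleared. *)
Lemma poly_roots_le m n j k : (j < m)%N -> (k < n)%N ->
  (j.*2.+1 * n.*2.+1 <= k.*2.+1 * m.*2.+1)%N -> (poly_roots n)`_k <= (poly_roots m)`_j.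
Proof.
move=> ltj ltk /root_angle_le le; rewrite !nth_poly_roots //.
have := root_angle_itv _ _ ltj; have := root_angle_itv _ _ ltk.
rewrite !in_itv /= => /andP[k0 kp] /andP[j0 jp].
by rewrite lerD2r ler_pM2l // leNgt ltr_cos ?in_itv /= ?ltW // -leNgt.
Qed.

Lemma poly_roots_lt0 n x : x \in poly_roots n -> x < 0.
Proof.
case/mapP => k; rewrite mem_iota => /andP[_ lt_kn] ->.
have := root_angle_itv _ _ lt_kn; rewrite in_itv /= => /andP[k0 kp].
have : cos (root_angle n k) < cos 0.
  by rewrite ltr_cos ?in_itv /= ?lexx ?pi_ge0 ?ltW.
rewrite cos0; lra.
Qed.

Lemma poly_roots_sorted n : sorted >%R (poly_roots n).
Proof.
apply/(sortedP 0) => i; rewrite size_poly_roots => lt.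
rewrite !nth_poly_roots ?(ltnW lt) //= ltrD2r ltr_pM2l //.
have := root_angle_itv _ _ lt; have := root_angle_itv _ _ (ltnW lt).
rewrite !in_itv /= => /andP[k0 kp] /andP[j0 jp].
by rewrite ltr_cos ?in_itv /= ?ltW // root_angle_lt.
Qed.

(* The factor cos(x/2) does not vanish because 0 < x < pi. *)
Lemma root_reduced_poly n k : (k < n)%N ->
  root (reduced_poly n) (2 * cos (root_angle n k) - 2).
Proof.
move=> lt_kn; have := root_angle_itv _ _ lt_kn; rewrite in_itv /= => /andP[k0 kp].
have := reduced_poly_cos n (root_angle n k).
have -> : (n%:R + 2^-1) * root_angle n k = pi / 2 + k%:R * pi.
  rewrite /root_angle -[k.*2.+1%:R]natr1 -[n.*2.+1%:R]natr1 -!mul2n !natrM; field.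
  by rewrite -natrM natr1 pnatr_eq0.
have -> : cos (pi / 2 + k%:R * pi) = 0 :> R.
  elim: k {lt_kn k0 kp} => [|k IH]; first by rewrite mul0r addr0 cos_pihalf.
  have -> : pi / 2 + k.+1%:R * pi = pi / 2 + k%:R * pi + pi :> R.
    by rewrite -[k.+1%:R]natr1; ring.
  by rewrite cosDpi IH oppr0.
move/eqP; rewrite mulf_eq0 => /orP[|//].
by rewrite gt_eqF // cos_gt0_pihalf //; apply/andP; split; lra.
Qed.

(** A monic polynomial of degree n with n distinct known roots is their product. *)
Lemma reduced_polyE n : reduced_poly n = \prod_(x <- poly_roots n) ('X - x%:P).
Proof.
have [[sn mn] _] := reduced_poly_monic n.
have := @all_roots_prod_XsubC _ (reduced_poly n) (poly_roots n).
rewrite (monicP mn) scale1r size_poly_roots; apply => //.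
  apply/allP => x /mapP[k]; rewrite mem_iota => /andP[_ ltk] ->.
  exact: root_reduced_poly.
rewrite uniq_rootsE; apply: (sorted_uniq _ _ (poly_roots_sorted n)).
  by move=> x y z xy yz; apply: lt_trans yz xy.
by move=> x; apply: ltxx.
Qed.

(** * Real-rootedness and interlacing *)

Lemma real_rooted_prod (s : seq R) : real_rooted (\prod_(x <- s) ('X - x%:P)).
Proof.
right=> z; rewrite rmorph_prod /=.
under eq_bigr do rewrite map_polyXsubC.
rewrite -(big_map (real_complex R) predT (fun x => 'X - x%:P)) root_prod_XsubC.
by case/mapP => x _ ->.
Qed.

Lemma admissible_prod (s : seq R) : admissible (\prod_(x <- s) ('X - x%:P)).
Proof.
split; first exact: real_rooted_prod.
by right; rewrite (monicP (monic_prod_XsubC _ _ _)) ltr01.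
Qed.

Lemma prod_cons0_roots n :
  'X * reduced_poly n = \prod_(x <- 0 :: poly_roots n) ('X - x%:P).
Proof. by rewrite big_cons subr0 -reduced_polyE. Qed.

Lemma zeros_of_prod (s : seq R) : sorted >=%R s ->
  zeros_of (\prod_(x <- s) ('X - x%:P)) s.
Proof. by split=> // x; rewrite mu_prod_XsubC. Qed.

Lemma cons0_roots_sorted n : sorted >=%R (0 :: poly_roots n).
Proof.
have : sorted >=%R (poly_roots n).
  by apply: sub_sorted (poly_roots_sorted n) => x y /ltW.
case E : (poly_roots n) => [//|x s] ss; apply/andP; split=> //.
by apply/ltW; apply: (poly_roots_lt0 n); rewrite E mem_head.
Qed.

(** Serves the step from index 1 to index 2, where both polynomials equal t. *)
Lemma interlaces_refl_prod (s : seq R) : sorted >=%R s ->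
  interlaces (\prod_(x <- s) ('X - x%:P)) (\prod_(x <- s) ('X - x%:P)).
Proof.
move=> ss; split; [exact: admissible_prod | exact: admissible_prod | apply: Or33].
exists s, s; split=> //; try exact: zeros_of_prod.
  by rewrite leqnn leqnSn.
by move=> i; move/(sortedP 0): ss; apply.
Qed.

(** The common zero 0 heads both lists, all others being negative. The rest is (2i+1)/(2n+3) <=
    (2i+1)/(2n+1) <= (2i+3)/(2n+3) for i < n. *)
Lemma interlaces_reduced_poly n :
  interlaces ('X * reduced_poly n) ('X * reduced_poly n.+1).
Proof.
rewrite !prod_cons0_roots.
split; [exact: admissible_prod | exact: admissible_prod | apply: Or33].
have size0 m : size (0 :: poly_roots m) = m.+1.
  exact: congr1 (size_poly_roots m).
have nthS x (s : seq R) i : (x :: s)`_i.+1 = s`_i by [].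
exists (0 :: poly_roots n), (0 :: poly_roots n.+1); rewrite !size0.
split; try by apply: zeros_of_prod; apply: cons0_roots_sorted.
- by rewrite leqnSn leqnn.
- move=> [_ //|i]; rewrite ltnS !(nthS 0) => lt_in.
  by apply: poly_roots_le; nia.
move=> [|i]; rewrite !ltnS !(nthS 0) => lt_in.
  by rewrite ltW // (poly_roots_lt0 n.+1) // mem_nth ?size_poly_roots.
by apply: poly_roots_le; nia.
Qed.

End Roots.

(** * From area sequences to words *)

Section Lows.
Local Open Scope nat_scope.
Variables (m : nat).
Implicit Types a : {ffun 'I_m.+1 -> 'I_m.+1}.

(** Made total on [nat] through [inord] so that it can be passed to [word]; only [k <= m] is
    meaningful. *)
Definition low a k := k - a (inord k).

Lemma low_ord a (i : 'I_m.+1) : low a i = i - a i.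
Proof. by rewrite /low inord_val. Qed.

(** The bound on [a i] stays separate because truncated subtraction hides it from [low]; given it,
    a_{i+1} <= a_i + 1 says that [low] does not decrease. *)
Lemma area_seqP a : reflect
  ((forall i : 'I_m.+1, a i <= i) /\ forall k, k < m -> low a k <= low a k.+1)
  (area_seq a).
Proof.
apply: (iffP andP) => [[/forallP ai /forallP aS]|[ai aS]].
  split=> // k lt_km; have := aS (inord k) => /forallP /(_ (inord k.+1)).
  have := ai (inord k); have := ai (inord k.+1).
  have [ltk ltk1] : k < m.+1 /\ k.+1 < m.+1 by lia.
  by rewrite /low !inordK // eqxx /=; lia.
split; apply/forallP => // i; apply/forallP => j; apply/implyP => /eqP ji.
have := aS i; rewrite -ji !low_ord; have := ai i; have := ai j; have := ltn_ord j; lia.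
Qed.

(** * Connectedness, peak-edges and nesting in terms of [low] *)

Section Graph.
Variable a : {ffun 'I_m.+1 -> 'I_m.+1}.
Hypothesis area_a : area_seq a.
Local Notation f := (low a).

Lemma low_le k : f k <= k. Proof. exact: leq_subr. Qed.

Lemma low_mono j k : j <= k -> k <= m -> f j <= f k.
Proof.
have [_ fm] := area_seqP _ area_a.
elim: k => [|k IH]; first by rewrite leqn0 => /eqP->.
rewrite leq_eqVlt => /orP[/eqP-> //|lejk] ltkm.
by apply: leq_trans (fm _ ltkm); apply: IH; lia.
Qed.

Lemma edge_ltE (j i : 'I_m.+1) : edge_lt a j i = (j < i) && (f i <= j).
Proof.
by have [ai _] := area_seqP _ area_a; rewrite /edge_lt low_ord; have := ai i; lia.
Qed.

Lemma adjE (j i : 'I_m.+1) : j < i -> adj a j i = (f i <= j).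
Proof. by rewrite /adj !edge_ltE; lia. Qed.

(** If [f k.+1 > k], monotonicity forbids every edge across the cut after [k]; otherwise consecutive
    vertices are adjacent. *)
Lemma connectedP : reflect (forall k, k < m -> f k.+1 <= k) (connected a).
Proof.
have sym : connect_sym (adj a) by apply: sym_connect_sym => i j; rewrite /adj orbC.
apply: (iffP forallP) => [con k ltkm|con].
  rewrite leqNgt; apply/negP => ltk.
  have : closed (adj a) [pred i : 'I_m.+1 | k < i].
    apply: intro_closed => // i j.
    rewrite !inE /adj !edge_ltE => /orP[|] /andP[lt le] ki; first by lia.
    by have := low_mono k.+1 i ki; have := ltn_ord i; lia.
  move=> /(closed_connect) /(_ _ (inord k.+1)) clo.
  have /forallP /(_ (inord k.+1)) /clo := con ord0.
  by rewrite !inE inordK //= ltnS leqnn ltn0.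
have con0 k : k <= m -> connect (adj a) ord0 (inord k).
  elim: k => [|k IH] lekm.
    by rewrite (_ : inord 0 = ord0) //; apply/val_inj; rewrite /= inordK.
  apply: connect_trans (IH (ltnW lekm)) (connect1 _).
  by rewrite adjE !inordK //; [apply: con | lia | lia].
move=> i; apply/forallP => j; apply: (@connect_trans _ _ ord0).
  by rewrite sym -(inord_val i) con0 // -ltnS.
by rewrite -(inord_val j) con0 // -ltnS.
Qed.

Definition block_end k := (k == m) || (f k < f k.+1).

(** For i < j, adjacency gives [f j <= i] and the absence of {i-1, j} gives [i <= f j]; the absence
    of {i, j+1} makes [j] a block end. An isolated vertex is the case [f i = i]. *)
Lemma peak_edgeE (p : 'I_m.+1 * 'I_m.+1) :
  peak_edge a p = (p.1 == f p.2 :> nat) && block_end p.2.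
Proof.
case: p => i j; rewrite /peak_edge /block_end /=.
have ltj := ltn_ord j; have lti := ltn_ord i.
have endE : i <= j ->
   [forall k : 'I_m.+1, (k == j.+1 :> nat) ==> ~~ adj a i k]
   = (j == m :> nat) || (i < f j.+1).
  move=> leij; apply/forallP/idP => [all|].
    case: eqP => //= ne; have := all (inord j.+1).
    have ltj1 : j.+1 < m.+1 by lia.
    by rewrite inordK // eqxx /= adjE inordK // -ltnNge.
  move=> H k; apply/implyP => /eqP kj; have := ltn_ord k.
  by rewrite adjE kj; lia.
have startE : i < j ->
   [forall k : 'I_m.+1, (k.+1 == i :> nat) ==> ~~ adj a k j] = (i <= f j).
  move=> ltij; apply/forallP/idP => [all|H k].
    have [-> //|i_gt0] := posnP i; have := all (inord i.-1).
    have ltk : i.-1 < m.+1 by lia.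
    by rewrite inordK // prednK // eqxx /= adjE inordK //; lia.
  by apply/implyP => /eqP ki; rewrite adjE; lia.
have := low_le j; have := low_mono j j.+1 (leqnSn j).
case: (ltngtP i j) => [ltij|ltji|/val_inj eij].
- rewrite (endE (ltnW ltij)) (startE ltij) (adjE _ _ ltij).
  have -> : (i == j) = false by apply/eqP => e; rewrite e ltnn in ltij.
  by rewrite /=; lia.
- have -> : (i == j) = false by apply/eqP => e; rewrite e ltnn in ltji.
  by rewrite /=; lia.
subst j; rewrite eqxx /= orbF => mono le.
apply/forallP/idP => [iso|H k].
  have fi : f i = i.
    apply/eqP; rewrite eqn_leq le /= leqNgt; apply/negP => lt.
    have := iso (inord i.-1).
    have lti1 : i.-1 < m.+1 by lia.
    by rewrite /adj orbC -[_ || _]/(adj a _ i) adjE inordK //; lia.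
  rewrite fi eqxx /=; case: eqP => //= ne.
  have lti1 : i.+1 < m.+1 by lia.
  by have := iso (inord i.+1); rewrite adjE inordK // -ltnNge.
have ltk := ltn_ord k; rewrite /adj !edge_ltE; apply/negP => /orP[] /andP[lt le'].
  by have := low_mono i.+1 k lt; lia.
by lia.
Qed.

Lemma peakE : peak a = \sum_(k < m.+1) block_end k.
Proof.
pose g (j : 'I_m.+1) : 'I_m.+1 * 'I_m.+1 := (inord (f j), j).
have lekf (j : 'I_m.+1) : f j < m.+1 by have := low_le j; have := ltn_ord j; lia.
rewrite /peak (_ : finset _ = g @: [set j : 'I_m.+1 | block_end j]).
  rewrite card_imset; last by move=> i j [].
  by rewrite -sum1dep_card big_mkcond /=; apply: eq_bigr => i _; case: block_end.
apply/setP => -[i j]; rewrite inE peak_edgeE /=; apply/andP/imsetP.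
  case=> /eqP ij be; exists j; rewrite ?inE // /g; congr pair.
  by apply/val_inj; rewrite /= inordK.
by case=> k; rewrite inE => be [-> ->]; rewrite inordK.
Qed.

Lemma peak_blocks : peak a = blocks (word f m.+1).
Proof.
rewrite peakE blocks_word big_ord_recr /= /block_end eqxx addn1; congr _.+1.
apply: eq_bigr => k _; have := low_mono k k.+1 (leqnSn k); have := ltn_ord k; lia.
Qed.

Lemma exists_block_end k : k <= m ->
  exists2 r, k <= r <= m & f r = f k /\ block_end r.
Proof.
move=> lekm; have [d] : exists d, m - k <= d by exists (m - k).
elim: d k lekm => [|d IH] k lekm led.
  by exists k; rewrite ?leqnn // /block_end; lia.
have [be|] := boolP (block_end k); first by exists k; rewrite ?leqnn.
rewrite negb_or -leqNgt => /andP[ne_km le_f].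
have ltkm : k < m by lia.
have mono := low_mono k k.+1 (leqnSn k) ltkm.
have [||r ler [fr br]] := IH k.+1; [lia | lia | exists r; first by lia].
by rewrite fr; split=> //; lia.
Qed.

Lemma peak_nestingE (v : 'I_m.+1) :
  peak_nesting a v = #|[set j : 'I_m.+1 | block_end j & f j <= v <= j]|.
Proof.
have lekf (j : 'I_m.+1) : f j < m.+1 by have := low_le j; have := ltn_ord j; lia.
pose g (j : 'I_m.+1) := Defs.interval (inord (f j), j).
rewrite -(@card_imset _ _ g); last first.
  (* Equal cliques have equal right ends: each end lies in the other clique. *)
  move=> i j /setP eij; apply/val_inj.
  have := eij i; have := eij j; rewrite !inE /= !inordK // !leqnn !low_le !andbT /=.
  by move=> e1 /esym e2; lia.
congr #|pred_of_set _|; apply/setP => K; rewrite inE; apply/andP/imsetP.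
  case=> /imsetP[[i j]]; rewrite inE peak_edgeE /= => /andP[/eqP ij be] -> vK.
  exists j; first by move: vK; rewrite !inE be -ij.
  by rewrite /g; congr (Defs.interval (_, _)); apply/val_inj; rewrite /= inordK.
case=> j; rewrite inE => /and3P[be le1 le2] ->; split; last by rewrite inE /= inordK ?le1.
by apply/imsetP; exists (inord (f j), j); rewrite // inE peak_edgeE /= inordK ?eqxx.
Qed.

(** Three peak-cliques with right ends x < y < z meet iff [f z <= x], and [f y.+1 <= f z] with
    equality when z is the next block end after y. *)
Lemma pnest_le2P : pnest a <= 2 <->
  forall i j, i < j < m -> f i < f i.+1 -> f j < f j.+1 -> i < f j.+1.
Proof.
split=> [/bigmax_leqP nest i j /andP[ltij ltjm] fi fj|H].
  rewrite ltnNge; apply/negP => lefi.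
  (* The cliques ending at [i], [j] and [r] would all contain [i]. *)
  have [r /andP[ltjr lerm] [fr br]] := exists_block_end _ ltjm.
  have [lti [ltj ltr]] : i < m.+1 /\ j < m.+1 /\ r < m.+1 by lia.
  have := nest (inord i) isT; rewrite peak_nestingE leqNgt => /negP; apply.
  apply/card_gt2P; exists (inord i), (inord j), (inord r).
  have mono := low_mono j j.+1 (leqnSn j) ltjm; have lei := low_le i.
  rewrite !inE !inordK // /block_end fi fj; split; last first.
    by split; apply/eqP => /(congr1 val); rewrite /= !inordK //; lia.
  by move: br; rewrite /block_end => br; split; lia.
apply/bigmax_leqP => v _; rewrite peak_nestingE leqNgt; apply/negP => /card_gt2P.
have incr (x y z : 'I_m.+1) : x < y -> y < z -> block_end x -> block_end y ->
    v <= x -> f z <= v -> False.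
  move=> ltxy ltyz; have := ltn_ord z; rewrite /block_end => ltz bx by_ vx fv.
  have := H x y; have := low_mono y.+1 z ltyz; lia.
move=> [x [y [z [[]]]]]; rewrite !inE -!(inj_eq val_inj) /=.
move=> /and3P[bx x1 x2] /and3P[b_y y1 y2] /and3P[bz z1 z2] [xy yz zx].
have [lxy|lxy] := ltnP x y; have [lyz|lyz] := ltnP y z; have [lxz|lxz] := ltnP x z.
all: try (exfalso; lia).
- exact: (incr x y z).
- by apply: (incr x z y) => //; lia.
- by apply: (incr z x y) => //; lia.
- by apply: (incr y x z) => //; lia.
- by apply: (incr y z x) => //; lia.
- by apply: (incr z y x) => //; lia.
Qed.

End Graph.

Lemma admissible_lowP a :
  area_seq a && ((pnest a <= 2) && connected a)
  <-> (forall i, a i <= i) /\ admissible_lows (low a) m.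
Proof.
split=> [/and3P[area /(pnest_le2P _ area) nest /(connectedP _ area) con]|[ai [_ fm fj]]].
  have [ai am] := area_seqP _ area; split=> //; split=> // i lt.
  by rewrite am ?con.
have area : area_seq a.
  by apply/area_seqP; split=> // k /fm /andP[].
apply/and3P; split=> //; first exact/pnest_le2P.
by apply/connectedP => // k /fm /andP[].
Qed.

End Lows.

(** Taking the word of [low] is a bijection onto [words n] that carries [peak] to [blocks]; its
    inverse sends f to i - f(i). *)
Lemma conn_peak_poly_words (R : realType) n :
  conn_peak_poly R n.+1 = word_poly R n.
Proof.
rewrite /conn_peak_poly /word_poly /=.
pose code (a : {ffun 'I_n.+1 -> 'I_n.+1}) := word (low _ a) n.+1.
pose S := [seq a <- index_enum {ffun 'I_n.+1 -> 'I_n.+1} |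
  [&& area_seq a, (pnest a <= 2)%N & connected a]].
have memS a : a \in S <-> (forall i, a i <= i)%N /\ admissible_lows (low _ a) n.
  by rewrite mem_filter mem_index_enum andbT; apply: admissible_lowP.
rewrite -(@perm_big _ _ _ _ [seq code a | a <- S]) /=.
  rewrite big_map [RHS]big_filter; apply: eq_bigr => a /andP[area _].
  by rewrite peak_blocks.
apply: uniq_perm; last 1 first.
- move=> w; apply/mapP/idP => [[a /memS[_ low_a] ->]|wn]; first exact/mem_words.
  move: (wn); rewrite [w]word_nth (size_words _ _ wn).
  set f := fun k => _; move=> fn; have /mem_words[f0 fm fj] := fn.
  have fle i : (i < n.+1)%N -> (f i <= i)%N.
    by case: i => [|i]; rewrite ?f0 // => /fm; lia.
  pose a := [ffun i : 'I_n.+1 => inord (i - f i) : 'I_n.+1].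
  have aE (i : 'I_n.+1) : a i = (i - f i)%N :> nat.
    by rewrite ffunE inordK //; have := ltn_ord i; lia.
  have lowE i : (i < n.+1)%N -> low _ a i = f i.
    by move=> lt; rewrite /low aE inordK // subKn ?fle.
  have code_a : word f n.+1 = code a by apply: eq_word => i /lowE.
  exists a => //; apply/memS; split; first by move=> i; rewrite aE; lia.
  by apply/mem_words; rewrite -/(code a) -code_a.
- rewrite map_inj_in_uniq ?filter_uniq ?index_enum_uniq // => a b.
  move=> /memS[ai _] /memS[bi _] eab; apply/ffunP => i; apply/val_inj.
  have := word_inj _ _ _ _ eab (ltn_ord i); rewrite !low_ord.
  by have := ai i; have := bi i => /=; lia.
exact: uniq_words.
Qed.

Lemma conn_peak_poly_reduced (R : realType) n :
  conn_peak_poly R n.+2 = 'X * reduced_poly R n.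
Proof.
rewrite conn_peak_poly_words.
suff: word_poly R n.+1 = 'X * reduced_poly R n /\
  word_poly R n.+2 = 'X * reduced_poly R n.+1 by case.
elim: n => [|n [IH1 IH2]].
  rewrite !(word_polyS, weighted_word_polyS) word_poly0 weighted_word_poly0 /=.
  by split; ring.
split=> //; rewrite word_poly_rec IH2 IH1 reduced_polySS; ring.
Qed.

Theorem corollary5p9 (R : realType) :
  [/\ conn_peak_poly R 1 = 'X,
      conn_peak_poly R 2 = 'X,
      forall n : nat, (3 <= n)%N ->
        conn_peak_poly R n =
          ('X + 2%:P) * conn_peak_poly R (n - 1) - conn_peak_poly R (n - 2),
      forall n : nat, real_rooted (conn_peak_poly R n)
    & generalized_sturm (conn_peak_poly R)].
Proof.
have P0 : conn_peak_poly R 0 = 0 by [].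
have P1 : conn_peak_poly R 1 = \prod_(x <- [:: 0]) ('X - x%:P).
  by rewrite conn_peak_poly_words word_poly0 big_seq1 subr0.
have P2 : conn_peak_poly R 2 = conn_peak_poly R 1.
  by rewrite conn_peak_poly_reduced mulr1 conn_peak_poly_words word_poly0.
have adm n : admissible (conn_peak_poly R n).
  case: n => [|[|n]]; first by split; left.
    by rewrite P1; apply: admissible_prod.
  by rewrite conn_peak_poly_reduced prod_cons0_roots; apply: admissible_prod.
split.
- by rewrite P1 big_seq1 subr0.
- by rewrite P2 P1 big_seq1 subr0.
- case=> [|[|[|n]]] // _; rewrite !subSS !subn0 !conn_peak_poly_words.
  exact: word_poly_rec.
- by move=> n; case: (adm n).
(* The step from 0 to 1 holds by the convention on the zero polynomial, and from 1 to 2 by equality;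
   the trigonometric zeros enter from index 3 on. *)
split=> // -[|[|[|n]]] //= _.
- by split=> //; apply: Or31.
- by rewrite P2 P1; apply: interlaces_refl_prod.
by rewrite !conn_peak_poly_reduced; apply: interlaces_reduced_poly.
Qed.
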